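(* Let $I\subset\mathbb{R}$ be a closed interval, let $f,g:I\to I$ be continuous, and let $p\in(0,1)$. Then for any $\varepsilon>0$ there exist continuous functions $f^\star,g^\star:I\to I$ such that $d(f,f^\star)<\varepsilon$, $d(g,g^\star)<\varepsilon$, and $\mu(f^\star,g^\star,p)=0$, where $d(u,v)=\sup_{x\in I}|u(x)-v(x)|$.
   Context: $I$ is a closed bounded interval of length $|I|>0$. For maps $f,g:I\to I$ and $p\in[0,1]$, consider the random dynamical system in which at each step, independently, $f$ is applied with probability $p$ and $g$ with probability $1-p$. Formally, $\Omega=\{f,g\}^{\infty}$ carries the product probability measure $P$ under which the coordinates $\omega_1,\omega_2,\ldots$ are independent with $P(\omega_i=f)=p$, $P(\omega_i=g)=1-p$ ($f$ and $g$ being treated as two distinct symbols). For $x\in I$ the trajectory is $x_0=x$, $x_n(\omega)=\omega_n\circ\omega_{n-1}\circ\cdots\circ\omega_1(x)$. For two starting points $x,y\in I$ the trajectories $x_n$ and $y_n$ are driven by the same $\omega$. Define, for $n\ge 1$ and $t\in\mathbb{R}$, $$F_{xy}^{(n)}(t)=\frac1n\sum_{i=0}^{n-1}P(|x_i-y_i|<t),\quad F_{xy}(t)=\liminf_{n\to\infty}F_{xy}^{(n)}(t),\quad F_{xy}^\star(t)=\limsup_{n\to\infty}F_{xy}^{(n)}(t),$$ and the measure of (distributional) chaos $$\mu(f,g,p)=\sup_{x,y\in I}\frac1{|I|}\int_0^{|I|}\bigl(F_{xy}^\star(t)-F_{xy}(t)\bigr)\,\mathrm{d}t .$$ *)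

(* Defs.v *)
From HB Require Import structures.
From mathcomp Require Import all_boot all_order all_algebra.
From mathcomp Require Import all_classical all_reals all_analysis measurable_realfun.
Set Implicit Arguments.
Unset Strict Implicit.
Unset Printing Implicit Defensive.
Import Order.TTheory GRing.Theory Num.Theory.
Import numFieldNormedType.Exports.
Local Open Scope classical_set_scope.
Local Open Scope ring_scope.

(* Omega = {f, g}^oo with [true] standing for the symbol f and [false] for g;
   coordinate i is the map applied at step i + 1. *)
Definition coordinate_events : set (set (nat -> bool)) :=
  \bigcup_i preimage_set_system setT (fun w : nat -> bool => w i) measurable.

Definition Omega := g_sigma_algebraType coordinate_events.

(* Realisation of the coin tosses on [0, 1[ with Lebesgue measure: the symbol is
   read off the side of p on which x lies, and that side is rescaled to [0, 1[. *)
Section coin_tosses.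
Context {R : realType}.
Implicit Types (p x : R).

Let rescale p x := if x < p then x / p else (x - p) / (1 - p).

Let toss p x : Omega := fun i => iter i (rescale p) x < p.

Let weight p (c : bool) := if c then p else 1 - p.

Let left_end p := fix l n (w : nat -> bool) : R :=
  if n is n'.+1 then
    if w 0%N then p * l n' (w \o S) else p + (1 - p) * l n' (w \o S)
  else 0.

Let toss_itv p n (w : nat -> bool) : 0 <= p <= 1 ->
  [/\ 0 <= left_end p n w, 0 <= \prod_(i < n) weight p (w i),
      left_end p n w + \prod_(i < n) weight p (w i) <= 1 &
      forall x, (0 <= x < 1 /\ forall i, (i < n)%N -> toss p x i = w i) <->
        left_end p n w <= x < left_end p n w + \prod_(i < n) weight p (w i)].
Proof.
move=> /andP[p0 p1]; elim: n w => [|n IH] w.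
  rewrite big_ord0 /= add0r; split => // x; split; [by case|by split].
rewrite big_ord_recl /= /bump /=.
have [l0 q0 lq1 IHx] := IH (w \o S).
set l := left_end p n (w \o S) in l0 lq1 IHx *.
rewrite /= in q0 lq1 IHx *.
set q := \prod_(i < n) weight p (w i.+1) in q0 lq1 IHx *.
have tossS x i : toss p x i.+1 = toss p (rescale p x) i by rewrite /toss iterSr.
have tossSP x : (forall i, (i < n.+1)%N -> toss p x i = w i) <->
    (x < p) = w 0%N /\ forall i, (i < n)%N -> toss p (rescale p x) i = w i.+1.
  split=> [h|[h0 h] [|i] ?]; last by rewrite tossS h.
  - by split=> [|i ?]; [exact: (h 0%N)|rewrite -tossS h].
  - exact: h0.
rewrite /weight; case: (w 0%N) tossSP => tossSP /=.
- split; [by rewrite mulr_ge0|by rewrite mulr_ge0| |move=> x].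
    by rewrite -mulrDr mulr_ile1// addr_ge0.
  split=> [[/andP[x0 x1] /tossSP[xp h]]|/andP[lx xlq]].
    have p_gt0 : 0 < p by exact: le_lt_trans xp.
    have /IHx : 0 <= rescale p x < 1 /\
        forall i, (i < n)%N -> toss p (rescale p x) i = w i.+1.
      split => //; rewrite /rescale xp divr_ge0//= ltr_pdivrMr// mul1r //.
    rewrite /rescale xp ler_pdivlMr// ltr_pdivrMr// => /andP[h1 h2].
    by rewrite ![p * _]mulrC h1/= -mulrDl.
  have p_gt0 : 0 < p.
    rewrite lt_neqAle p0 andbT; apply/eqP => pE; move: lx xlq.
    by rewrite -pE !mul0r addr0 => /le_lt_trans h /h; rewrite ltxx.
  have xp : x < p.
    by apply: (lt_le_trans xlq); rewrite -mulrDr -[leRHS]mulr1 ler_wpM2l.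
  have x0 : 0 <= x by apply: le_trans lx; rewrite mulr_ge0.
  split; first by rewrite x0/= (lt_le_trans xp).
  apply/tossSP; split => //.
  have /IHx[//] : l <= rescale p x < l + q.
  rewrite /rescale xp ler_pdivlMr// ltr_pdivrMr//.
  by rewrite ![_ * p]mulrC lx/= mulrDr.
- have p'0 : 0 <= 1 - p by rewrite subr_ge0.
  split; [by rewrite addr_ge0// mulr_ge0|by rewrite mulr_ge0| |move=> x].
    rewrite -addrA -mulrDr -[leRHS](subrKC p) lerD2l -[leRHS]mulr1.
    by rewrite ler_wpM2l.
  split=> [[/andP[x0 x1] /tossSP[xp h]]|/andP[lx xlq]].
    have px : p <= x by rewrite leNgt xp.
    have p_lt1 : 0 < 1 - p by rewrite subr_gt0 (le_lt_trans px).
    have /IHx : 0 <= rescale p x < 1 /\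
        forall i, (i < n)%N -> toss p (rescale p x) i = w i.+1.
      split => //; rewrite /rescale xp divr_ge0 ?subr_ge0//=.
      by rewrite ltr_pdivrMr// mul1r ltrD2r.
    rewrite /rescale xp ler_pdivlMr// ltr_pdivrMr// => /andP[h1 h2].
    apply/andP; split; first by rewrite -lerBrDl mulrC.
    by rewrite -addrA -ltrBlDl -mulrDr mulrC.
  have p_lt1 : 0 < 1 - p.
    rewrite lt_neqAle p'0 andbT; apply/eqP => pE; move: lx xlq.
    by rewrite -pE !mul0r !addr0 => /le_lt_trans h /h; rewrite ltxx.
  have px : p <= x by apply: le_trans lx; rewrite lerDl mulr_ge0.
  have xp : (x < p) = false by rewrite ltNge px.
  have x1 : x < 1.
    apply: (lt_le_trans xlq).
    rewrite -addrA -mulrDr -[leRHS](subrKC p) lerD2l -[leRHS]mulr1.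
    by rewrite ler_wpM2l.
  split; first by rewrite (le_trans p0 px).
  apply/tossSP; split => //.
  have /IHx[//] : l <= rescale p x < l + q.
  rewrite /rescale xp ler_pdivlMr// ltr_pdivrMr//.
  by rewrite lerBrDl ltrBlDl ![_ * (1 - p)]mulrC lx/= mulrDr addrA.
Qed.

Let measurable_rescale p : measurable_fun setT (rescale p).
Proof.
apply: measurable_fun_ifT; first exact: measurable_fun_ltr.
- exact: measurable_funM.
- by apply: measurable_funM => //; exact: measurable_funB.
Qed.

Let measurable_toss p : measurable_fun setT (toss p).
Proof.
apply: (@measurability _ _ _ Omega setT (toss p) coordinate_events) => //.
move=> _ [_ [i _ [B mB <-]] <-].
have mi : measurable_fun setT (fun x => toss p x i).
  apply: measurable_fun_ltr => //.
  elim: i => [|i IH] /=; first exact: measurable_id.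
  exact: measurableT_comp IH.
rewrite [X in measurable X](_ : _ = setT `&` (fun x => toss p x i) @^-1` B).
  exact: mi.
by rewrite !setTI.
Qed.

Definition unif01 (A : set R) : \bar R := lebesgue_measure (A `&` `[0, 1[%classic).

Let unif0 : unif01 set0 = 0%E.
Proof. by rewrite /unif01 set0I measure0. Qed.

Let unif_ge0 A : (0 <= unif01 A)%E. Proof. exact: measure_ge0. Qed.

Let unif_sigma_additive : semi_sigma_additive unif01.
Proof.
exact: (@measure_semi_sigma_additive _ _ _
  (mrestr lebesgue_measure (measurable_itv `[0, 1[%R))).
Qed.

HB.instance Definition _ := isMeasure.Build _ _ _ unif01
  unif0 unif_ge0 unif_sigma_additive.

Let unif_setT : unif01 setT = 1%E.
Proof.
by rewrite /unif01 setTI lebesgue_measure_itv /= lte01 oppr0 adde0.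
Qed.

HB.instance Definition _ :=
  @Measure_isProbability.Build _ _ R unif01 unif_setT.

Let measurable_coordinate i : measurable_fun setT (fun w : Omega => w i).
Proof.
move=> _ B mB; apply: sub_sigma_algebra; exists i => //; by exists B.
Qed.

Let measurable_rect n (A : nat -> set bool) :
  measurable [set w : Omega | forall i, (i < n)%N -> A i (w i)].
Proof.
rewrite [X in measurable X](_ : _ =
    \bigcap_(i < n) (setT `&` (fun w : Omega => w i) @^-1` (A i))).
  by apply: bigcap_measurableType => i _; exact: measurable_coordinate.
apply/seteqP; split => [w h i /= ?|w h i ?]; first by split => //; exact: h.
by have [] := h i.
Qed.

Let cylinder_rect (P : probability Omega R) p n :
  (forall w : nat -> bool, P [set v | forall i, (i < n)%N -> v i = w i] =
     (\prod_(i < n) bernoulli_prob p [set w i])%E) ->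
  forall A : nat -> set bool,
    P [set w | forall i, (i < n)%N -> A i (w i)] =
      (\prod_(i < n) bernoulli_prob p (A i))%E.
Proof.
move=> Pw.
suff rec k (A : nat -> set bool) : (k <= n)%N ->
    (forall i, (k <= i < n)%N -> exists c, A i = [set c]) ->
    P [set w | forall i, (i < n)%N -> A i (w i)] =
      (\prod_(i < n) bernoulli_prob p (A i))%E.
  move=> A; apply: (rec n) => // i /andP[ni].
  by rewrite ltnNge ni.
elim: k A => [|k IH] A kn hA.
  have /choice[w hw] : forall i, exists c, (i < n)%N -> A i = [set c].
    move=> i; have [ni|_] := ltnP i n; last by exists true.
    by have [c ->] := hA i ni; exists c.
  rewrite (_ : [set _ | _] = [set v | forall i, (i < n)%N -> v i = w i]); last first.
    by apply/seteqP; split => v h i ni; have := h i ni; rewrite hw.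
  by rewrite Pw; apply: eq_bigr => i _; rewrite hw.
pose A' c i := if i == k then A k `&` [set c] else A i.
pose E c := [set w : Omega | forall i, (i < n)%N -> A' c i (w i)].
have PE c : P (E c) = (\prod_(i < n) bernoulli_prob p (A' c i))%E.
  have [Akc|Akc] := pselect (A k c).
    apply: IH => [|i /andP[ki ni]]; first exact: ltnW.
    rewrite /A'; case: eqP => [_|/eqP nik].
      by exists c; apply/seteqP; split => [d []|d /= ->].
    by apply: hA; rewrite ni andbT ltn_neqAle eq_sym nik.
  have A'0 : A' c k = set0.
    by rewrite /A' eqxx; apply/seteqP; split => [d [+ /= dc]|//]; rewrite dc.
  rewrite (_ : E c = set0); last first.
    by apply/seteqP; split => // w /(_ k kn); rewrite A'0.
  by rewrite measure0 (bigD1 (Ordinal kn))//= A'0 measure0 mul0e.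
have -> : [set w : Omega | forall i, (i < n)%N -> A i (w i)] =
    E true `|` E false.
  apply/seteqP; split => w.
    move=> h; case wk: (w k); [left|right] => i ni; rewrite /A';
      by case: eqP => [->|_]; [split; [exact: h|]|exact: h].
  move=> [] h i ni; have := h i ni; rewrite /A'; by case: eqP => [->[]|].
have -> : P (E true `|` E false) = (P (E true) + P (E false))%E.
  apply: measureU; [exact: measurable_rect|exact: measurable_rect|].
  apply/seteqP; split => // w [/(_ k kn) + /(_ k kn)].
  by rewrite /A' eqxx => -[_ /= ->] [].
rewrite !PE (bigD1 (Ordinal kn))//= [X in (_ + X)%E](bigD1 (Ordinal kn))//=.
rewrite [RHS](bigD1 (Ordinal kn))//=.
have rest c : (\prod_(i < n | i != Ordinal kn) bernoulli_prob p (A' c i) =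
            \prod_(i < n | i != Ordinal kn) bernoulli_prob p (A i))%E.
  apply: eq_bigr => i; rewrite /A' -val_eqE /= => /negbTE ->//.
rewrite !rest -ge0_muleDl; [|exact: measure_ge0|exact: measure_ge0].
congr (_ * _)%E; rewrite /A' eqxx -measureU//.
  by rewrite -setIUr -setT_bool setIT.
by apply/seteqP; split => // d [[_ /= ->] []].
Qed.

Lemma exists_coin_prob p : exists P : probability Omega R,
  forall n (A : nat -> set bool),
    P [set w | forall i, (i < n)%N -> A i (w i)] =
      (\prod_(i < n) bernoulli_prob p (A i))%E.
Proof.
wlog p01 : p / 0 <= p <= 1.
  move=> H; have [|np01] := boolP (0 <= p <= 1); first exact: H.
  have [|P HP] := H 0; first by rewrite lexx ler01.
  exists P => n A; rewrite HP; apply: eq_bigr => i _.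
  rewrite -(@eq_bernoulli _ 0 (bernoulli_prob p))//.
  by rewrite /= /bernoulli_prob (negbTE np01) diracE memNset.
pose X : {mfun R >-> Omega} := mfun_Sub (mem_set (@measurable_toss p)).
exists (distribution unif01 X) => n; apply: cylinder_rect => w.
have [l0 q0 lq1 H] := toss_itv n w p01.
rewrite /distribution /pushforward /= /unif01.
rewrite [X in lebesgue_measure X](_ : _ = `[left_end p n w,
    left_end p n w + \prod_(i < n) weight p (w i)[%classic); last first.
  apply/seteqP; split => x /=.
    by move=> [h]; rewrite !in_itv /= => x01; apply/H; split.
  by rewrite !in_itv /= => /H[? ?]; split.
rewrite lebesgue_measure_itv /= lte_fin ltrDl.
have -> : (\prod_(i < n) bernoulli_prob p [set w i] =
           (\prod_(i < n) weight p (w i))%:E)%E.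
  rewrite -prodEFin; apply: eq_bigr => i _.
  by rewrite /bernoulli_prob p01 fsbig_set1.
case: ltgtP q0 => // [_ _|<- _//].
by rewrite -EFinB addrAC subrr add0r.
Qed.

End coin_tosses.

(* The product measure on Omega of the law p delta_f + (1 - p) delta_g; it is
   determined by its values on the rectangles, given by [coin_probE]. *)
Definition coin_prob (R : realType) (p : R) : probability Omega R :=
  sval (cid (exists_coin_prob p)).

Lemma coin_probE (R : realType) (p : R) n (A : nat -> set bool) :
  coin_prob p [set w | forall i, (i < n)%N -> A i (w i)] =
    (\prod_(i < n) bernoulli_prob p (A i))%E.
Proof. exact: (svalP (cid (exists_coin_prob p))). Qed.

Section chaos.
Context {R : realType}.
Implicit Types (f g : R -> R) (p x y t a b : R).

Fixpoint trajectory f g (w : Omega) x n : R :=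
  if n is m.+1 then (if w m then f else g) (trajectory f g w x m) else x.

Definition Fn f g p x y (n : nat) t : \bar R :=
  ((n%:R^-1)%:E * \sum_(0 <= i < n)
     coin_prob p [set w | (`|trajectory f g w x i - trajectory f g w y i| < t)%R])%E.

Definition Flow f g p x y t : \bar R := limn_einf (fun n => Fn f g p x y n t).

Definition Fup f g p x y t : \bar R := limn_esup (fun n => Fn f g p x y n t).

Definition chaos_measure a b f g p : \bar R :=
  ereal_sup [set (((b - a)^-1)%:E *
      \int[lebesgue_measure]_(t in `[0%R, (b - a)%R]) (Fup f g p x y t - Flow f g p x y t))%E
    | x in `[a, b] & y in `[a, b]].

Definition sup_dist a b (u v : R -> R) : \bar R :=
  ereal_sup [set `|u x - v x|%:E | x in `[a, b]].

End chaos.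

(* Main.v *)
(* Replace f and g by staircases with values in the finite set S of midpoints of
   a fine subdivision, with short ramps between the plateaus; the ramps of f* and
   of g* are disjoint and avoid S.  Then f* and g* preserve S, and every point is
   sent into S by at least one of them, so the pair (x_n, y_n) a.s. ends up in
   S x S.  There it is a finite Markov chain, for which Cesaro averages always
   converge because the state functions split into ker(M - 1) + im(M - 1).
   Hence F and F* coincide for all x, y and t. *)
Require Import Defs.
From HB Require Import structures.
From mathcomp Require Import all_boot all_order all_algebra.
From mathcomp Require Import all_classical all_reals all_analysis.
From mathcomp Require Import ring lra.
Import Order.TTheory GRing.Theory Num.Theory.
Import numFieldNormedType.Exports.
Local Open Scope classical_set_scope.
Local Open Scope ring_scope.

(** * Averages over random compositions of two maps *)

Section random_dynamics.
Context {R : realType}.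

(** The expectation of [phi] after [n] random steps from [z], that is, the [n]-th power of the
    Markov operator [M] applied to [phi]. The recursion splits off the first step, whereas
    [trajectory] unfolds the last one. *)
Fixpoint coin_avg {T : Type} (p : R) (F G : T -> T) (phi : T -> R) n z : R :=
  if n is m.+1
  then p * coin_avg p F G phi m (F z) + (1 - p) * coin_avg p F G phi m (G z)
  else phi z.

Lemma coin_avg_le (T : Type) (p K : R) (F G : T -> T) (phi : T -> R) n z :
  0 <= p <= 1 -> (forall z, `|phi z| <= K) ->
  `|coin_avg p F G phi n z| <= K.
Proof.
move=> /andP[p0 p1] phiK; elim: n z => [|n IH] z //=.
rewrite (le_trans (ler_normD _ _))// !normrM (ger0_norm p0).
rewrite (ger0_norm (_ : 0 <= 1 - p)) ?subr_ge0//.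
rewrite (_ : K = p * K + (1 - p) * K); last by ring.
by apply: lerD; apply: ler_wpM2l; rewrite ?subr_ge0//; exact: IH.
Qed.

(** * Finite chains: invariant functions and drifts *)

Section decomposition.
Context (T : finType) (p : R) (F G : T -> T).

Let V := {ffun T -> R^o}.

(** The operator [M - 1], on a finite-dimensional space so that rank and nullity can be compared. *)
Definition coin_drift (v : V) : V :=
  [ffun x => p * v (F x) + (1 - p) * v (G x) - v x].

Let coin_drift_is_linear : linear coin_drift.
Proof.
by move=> k u v; apply/ffunP => x; rewrite !ffunE /= /GRing.scale /=; ring.
Qed.

HB.instance Definition _ :=
  GRing.isLinear.Build R V V _ coin_drift coin_drift_is_linear.

Let drift := linfun coin_drift.

Let driftE v x : drift v x = p * v (F x) + (1 - p) * v (G x) - v x.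
Proof. by rewrite lfunE /= ffunE. Qed.

Let lker_driftP (u : V) : u \in lker drift ->
  forall x, u x = p * u (F x) + (1 - p) * u (G x).
Proof.
rewrite memv_ker => /eqP u0 x; apply/eqP; rewrite eq_sym -subr_eq0 -driftE u0.
by rewrite ffunE.
Qed.

Lemma ffun_bounded (v : T -> R) : exists K, forall x, `|v x| <= K.
Proof.
exists (\sum_x `|v x|) => x.
by rewrite (bigD1 x)//= lerDl sumr_ge0.
Qed.

(* If u is invariant and u = drift v, the averages of v grow linearly with slope u,
   whereas they are bounded. *)
Let drift_disjoint : 0 <= p <= 1 -> (lker drift :&: limg drift = 0)%VS.
Proof.
move=> p01; apply/eqP; rewrite -subv0; apply/subvP => u.
rewrite memv_cap memv0 => /andP[/lker_driftP uinv /memv_imgP[v _ uE]].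
have grow n x : coin_avg p F G v n x = v x + n%:R * u x.
  elim: n x => [|n IH] x /=; first by rewrite mul0r addr0.
  have := driftE v x; rewrite -uE => ux.
  rewrite !IH -natr1.
  rewrite (_ : (n%:R + 1) * u x = n%:R * (p * u (F x) + (1 - p) * u (G x)) + u x).
    by rewrite [in RHS]ux; ring.
  by rewrite -uinv mulrDl mul1r.
have [K vK] := ffun_bounded v.
apply/eqP/ffunP => x; rewrite ffunE; apply/eqP; apply: contraT => ux0.
have ux : 0 < `|u x| by rewrite normr_gt0.
(* With this [n], [n * |u x|] exceeds [2 * K], although it is at most the sum of two absolute values
   bounded by [K]. *)
pose n := (Num.truncn (2 * K / `|u x|)).+1.
have : 2 * K / `|u x| < n%:R by exact: truncnS_gt.
rewrite ltr_pdivrMr// => nK.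
have := coin_avg_le T p K F G v n x p01 vK.
have := vK x.
rewrite grow.
have : `|n%:R * u x| <= `|v x + n%:R * u x| + `|v x|.
  by rewrite -[X in `|X|](addKr (v x)) addrC (le_trans (ler_normB _ _)).
rewrite normrM normr_nat => h1 h2 h3; exfalso; lra.
Qed.

(** Kernel and image of the drift meet trivially and by rank-nullity their dimensions add up to that
    of the whole space, so together they span it. *)
Lemma coin_decomposition (phi : T -> R) : 0 <= p <= 1 ->
  exists u v : T -> R,
    (forall x, u x = p * u (F x) + (1 - p) * u (G x)) /\
    (forall x, phi x = u x + (p * v (F x) + (1 - p) * v (G x) - v x)).
Proof.
move=> p01.
have full : (lker drift + limg drift = fullv)%VS.
  apply/eqP; rewrite -dimv_leqif_eq ?subvf//.
  rewrite dimv_disjoint_sum ?drift_disjoint//.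
  by rewrite -[lker drift in X in (X + _)%N]capfv limg_ker_dim.
have : [ffun x => phi x] \in (lker drift + limg drift)%VS.
  by rewrite full memvf.
move=> /memv_addP[u uker [w /memv_imgP[v _ ->] phiE]].
exists u, v; split; first exact: lker_driftP.
by move=> x; rewrite -driftE; move/ffunP: phiE => /(_ x); rewrite !ffunE.
Qed.

End decomposition.

(** * Cesaro means and their oscillation *)

Definition cesaro (u : nat -> R) n : R := n%:R^-1 * \sum_(0 <= i < n) u i.

(** For a bounded sequence this says that limsup minus liminf is at most [d]. The case [d = 0] is
    the Cauchy property; a general [d] can be contracted step by step. *)
Definition osc_le (u : nat -> R) d :=
  forall e, 0 < e -> exists N, forall m n, (N <= m)%N -> (N <= n)%N ->
    `|u m - u n| <= d + e.

Lemma osc_le_trans u d d' : d <= d' -> osc_le u d -> osc_le u d'.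
Proof.
move=> dd' ud e e0; have [N uN] := ud e e0.
by exists N => m n Nm Nn; rewrite (le_trans (uN m n Nm Nn))// lerD2r.
Qed.

Lemma near_invn_le (K e : R) : 0 < e ->
  exists N, forall n, (N <= n)%N -> (0 < n)%N /\ K / n%:R <= e.
Proof.
move=> e0; exists (Num.truncn (K / e)).+1 => n Nn.
have n0 : (0 < n)%N by exact: leq_ltn_trans Nn.
split=> //; rewrite ler_pdivrMr ?ltr0n// mulrC -ler_pdivrMr//.
by rewrite (le_trans (ltW (truncnS_gt _)))// ler_nat.
Qed.

(** Writing [phi] as [u] plus the drift of [v], the invariant part contributes [u z] at each time
    and the drift part telescopes, so the mean differs from [u z] by at most [2 * K / n]. *)
Lemma cesaro_coin_avg_finite (T : finType) (p : R) (F G : T -> T)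
    (phi : T -> R) z :
  0 <= p <= 1 -> osc_le (cesaro (fun i => coin_avg p F G phi i z)) 0.
Proof.
move=> p01; have [u [v [uinv phiE]]] := coin_decomposition _ p F G phi p01.
have avgE n x : coin_avg p F G phi n x =
    u x + (coin_avg p F G v n.+1 x - coin_avg p F G v n x).
  elim: n x => [|n IH] x /=; first exact: phiE.
  by rewrite !IH /= [in RHS]uinv; ring.
have sumE n : \sum_(0 <= i < n) coin_avg p F G phi i z =
    n%:R * u z + (coin_avg p F G v n z - v z).
  rewrite (eq_bigr _ (fun i _ => avgE i z)) big_split /= sumr_const_nat subn0.
  by rewrite telescope_sumr// mulr_natl.
have [K vK] := ffun_bounded _ v.
have bound n : (0 < n)%N ->
    `|cesaro (fun i => coin_avg p F G phi i z) n - u z| <= 2 * K / n%:R.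
  move=> n0; rewrite /cesaro sumE mulrDr mulKf ?pnatr_eq0 -?lt0n//.
  rewrite addrC addKr normrM normfV normr_nat mulrC ler_wpM2r ?invr_ge0//.
  rewrite (le_trans (ler_normB _ _))//.
  by have := coin_avg_le _ p K F G v n z p01 vK; have := vK z; lra.
move=> e e0; have [N HN] := near_invn_le (2 * K) (e / 2) ltac:(lra).
exists N => m n /HN[m0 mN] /HN[n0 nN].
have := bound m m0; have := bound n n0.
set a := cesaro _ m; set b := cesaro _ n; rewrite !ler_norml; lra.
Qed.

(** * Absorption into a set on which the means converge *)

Section absorption.
Context {T : Type} (p K : R) (F G : T -> T) (phi : T -> R).
Hypotheses (p01 : 0 < p < 1) (phiK : forall z, `|phi z| <= K).

Let A z := cesaro (fun i => coin_avg p F G phi i z).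

Let p01w : 0 <= p <= 1.
Proof. by case/andP: p01 => p0 p1; rewrite !ltW. Qed.

Let cesaro_bound n z : `|A z n| <= K.
Proof.
have K0 : 0 <= K by exact: le_trans (phiK z).
case: n => [|n]; first by rewrite /A /cesaro big_nil mulr0 normr0.
rewrite /A /cesaro normrM normfV normr_nat mulrC ler_pdivrMr ?ltr0n//.
rewrite (le_trans (ler_norm_sum _ _ _))//.
rewrite (@le_trans _ _ (\sum_(0 <= i < n.+1) K))//.
  by apply: ler_sum => i _; exact: coin_avg_le.
by rewrite sumr_const_nat subn0 mulr_natr.
Qed.

(** Averaging over the first step shifts time by one, so the two sums differ only in their end
    terms, at times [0] and [n]. *)
Let cesaro_step n z : (0 < n)%N ->
  `|A z n - (p * A (F z) n + (1 - p) * A (G z) n)| <= 2 * K / n%:R.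
Proof.
move=> n0.
have -> : A z n - (p * A (F z) n + (1 - p) * A (G z) n) =
    n%:R^-1 * (phi z - coin_avg p F G phi n z).
  rewrite /A /cesaro !(mulrCA _ n%:R^-1) -!mulrDr -mulrBr; congr (_ * _).
  rewrite !big_distrr/= -big_split/=.
  rewrite -[LHS]opprB -sumrB.
  rewrite (_ : \sum_(0 <= i < n) _ =
    \sum_(0 <= i < n) (coin_avg p F G phi i.+1 z - coin_avg p F G phi i z))//.
  by rewrite telescope_sumr//= opprB.
rewrite normrM normfV normr_nat mulrC ler_wpM2r ?invr_ge0//.
rewrite (le_trans (ler_normB _ _))//.
by have := coin_avg_le _ p K F G phi n z p01w phiK; have := phiK z; lra.
Qed.

Let osc_step d1 d2 z : osc_le (A (F z)) d1 -> osc_le (A (G z)) d2 ->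
  osc_le (A z) (p * d1 + (1 - p) * d2).
Proof.
move=> F1 G2 e e0; have e2 : 0 < e / 2 by lra.
have [N1 HF] := F1 _ e2; have [N2 HG] := G2 _ e2.
(* The shift errors at [m] and [n] cost [e / 4] each; the weighted oscillations of the two images
   use the other [e / 2]. *)
have [N3 HN] := near_invn_le (2 * K) (e / 4) ltac:(lra).
exists (maxn N1 (maxn N2 N3)) => m n.
rewrite !geq_max => /and3P[m1 m2 /HN[m0 mK]] /and3P[n1 n2 /HN[n0 nK]].
have [p0 p1] := andP p01.
have hF : `|p * (A (F z) m - A (F z) n)| <= p * (d1 + e / 2).
  by rewrite normrM gtr0_norm// ler_pM2l// HF.
have hG : `|(1 - p) * (A (G z) m - A (G z) n)| <= (1 - p) * (d2 + e / 2).
  by rewrite normrM gtr0_norm ?subr_gt0// ler_pM2l ?subr_gt0// HG.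
have := cesaro_step m z m0; have := cesaro_step n z n0.
move: hF hG; rewrite !ler_norml; lra.
Qed.

(* Each step has probability at least 1 - max(p, 1 - p) of entering Z, so the
   oscillation on E shrinks by the factor max(p, 1 - p). *)
Lemma cesaro_absorption (Z E : set T) :
  (forall z, E z -> E (F z)) -> (forall z, E z -> E (G z)) ->
  (forall z, E z -> Z (F z) \/ Z (G z)) ->
  (forall z, Z z -> osc_le (A z) 0) ->
  forall z, E z -> osc_le (A z) 0.
Proof.
move=> EF EG EZ Z0; have [p0 p1] := andP p01.
pose r := Num.max p (1 - p).
have r0 : 0 <= r by rewrite le_max ltW.
have rp : p <= r by rewrite le_max lexx.
have rp' : 1 - p <= r by rewrite le_max lexx orbT.
have r1 : r < 1 by rewrite gt_max p1/=; lra.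
have osck k z : E z -> osc_le (A z) (r ^+ k * (2 * K)).
  elim: k z => [|k IH] z Ez.
    move=> e e0; exists 0%N => m n _ _; rewrite mul1r.
    rewrite (le_trans (ler_normB _ _))//.
    by have := cesaro_bound m z; have := cesaro_bound n z; lra.
  have K0 : 0 <= K by exact: le_trans (phiK z).
  have d0 : 0 <= r ^+ k * (2 * K) by rewrite !mulr_ge0// exprn_ge0.
  rewrite exprS -mulrA.
  case: (EZ z Ez) => /Z0 hZ.
    apply: osc_le_trans (osc_step _ _ _ hZ (IH _ (EG _ Ez))).
    by rewrite mulr0 add0r ler_wpM2r.
  apply: osc_le_trans (osc_step _ _ _ (IH _ (EF _ Ez)) hZ).
  by rewrite mulr0 addr0 ler_wpM2r.
move=> z Ez e e0; have e2 : 0 < e / 2 by lra.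
have K0 : 0 <= K by exact: le_trans (phiK z).
have [k rk] : exists k, r ^+ k * (2 * K) <= e / 2.
  have : r ^+ n * (2 * K) @[n --> \oo] --> (0 * (2 * K) : R).
    by apply: cvgMl; apply: cvg_expr; rewrite ger0_norm.
  rewrite mul0r => /cvgr_le /(_ _ e2)[k _ kP].
  by exists k; exact: (kP k (leqnn k)).
have [N HN] := osck k z Ez _ e2.
by exists N => m n Nm Nn; rewrite (le_trans (HN m n Nm Nn))//; lra.
Qed.

End absorption.

Lemma osc0_cvg (u : nat -> R) : osc_le u 0 -> cvgn u.
Proof.
move=> u0; apply/cauchy_cvgP/cauchy_ballP => e e0.
have [N HN] := u0 (e / 2) ltac:(lra).
pose S := u @` [set n | (N <= n)%N].
have uS : (u @ \oo) S by exists N => // n Nn; exists n.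
exists (S, S) => // -[_ _] /= [[m Nm <-] [n Nn <-]].
by rewrite /ball /= (le_lt_trans (HN m n Nm Nn))//; lra.
Qed.

(** * Law of the pair of trajectories *)

Lemma trajectory_eq_prefix (f g : R -> R) (w u : Omega) x k :
  (forall i, (i < k)%N -> w i = u i) ->
  trajectory f g w x k = trajectory f g u x k.
Proof.
elim: k => [//|k IH] wu /=; rewrite wu// IH// => i ik.
by apply: wu; rewrite ltnW.
Qed.

Lemma measurable_cylinder k (u : Omega) :
  measurable [set w : Omega | forall i, (i < k)%N -> w i = u i].
Proof.
rewrite (_ : mkset _ = \bigcap_(i < k) (setT `&` (fun w : Omega => w i) @^-1` [set u i])).
  apply: bigcap_measurableType => i _; apply: sub_sigma_algebra.
  by exists i => //; exists [set u i].
by apply/seteqP; split => w h i ik; [split=> //; exact: h|have [] := h i ik].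
Qed.

Lemma coin_prob_cylinder (p : R) k (u : Omega) : 0 <= p <= 1 ->
  coin_prob p [set w | forall i, (i < k)%N -> w i = u i] =
    (\prod_(i < k) (if u i then p else 1 - p))%:E.
Proof.
move=> p01; rewrite (coin_probE p k (fun i => [set u i])) -prodEFin.
by apply: eq_bigr => i _; rewrite /bernoulli_prob p01 fsbig_set1.
Qed.

Section pair_process.
Context (p : R) (f g : R -> R) (x y : R) (B : R * R -> bool).
Hypothesis p01 : 0 <= p <= 1.

Let pair_traj (w : Omega) n := (trajectory f g w x n, trajectory f g w y n).

Let avg := coin_avg p (fun z : R * R => (f z.1, f z.2))
  (fun z : R * R => (g z.1, g z.2)) (fun z => (B z)%:R).

(* Conditioning on the first k tosses; the induction splits on toss number k. *)
Let coin_prob_prefix n k (u : Omega) :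
  let E := [set w : Omega | (forall i, (i < k)%N -> w i = u i) /\
                            B (pair_traj w (n + k))] in
  measurable E /\
  coin_prob p E =
    (\prod_(i < k) (if u i then p else 1 - p) * avg n (pair_traj u k))%:E.
Proof.
elim: n k u => [|n IH] k u /=.
  have prefixE w : (forall i, (i < k)%N -> w i = u i) ->
      pair_traj w k = pair_traj u k.
    by move=> wu; rewrite /pair_traj !(trajectory_eq_prefix f g w u _ k wu).
  case Bu : (B (pair_traj u k)).
    rewrite (_ : mkset _ = [set w | forall i, (i < k)%N -> w i = u i]).
      rewrite /avg /= Bu mulr1; split; [exact: measurable_cylinder|exact: coin_prob_cylinder].
    by apply/seteqP; split => w => [[]//|wu]; split=> //; rewrite add0n prefixE.
  rewrite (_ : mkset _ = set0) /avg /= ?Bu ?mulr0 ?measure0//.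
  by apply/seteqP; split => // w [/prefixE wu]; rewrite add0n wu Bu.
pose u' c : Omega := fun i => if i == k then c else u i.
pose E c := [set w : Omega | (forall i, (i < k.+1)%N -> w i = u' c i) /\
                             B (pair_traj w (n + k.+1))].
have u'E c i : (i < k)%N -> u' c i = u i by rewrite /u'; case: ltngtP.
have u'k c : u' c k = c by rewrite /u' eqxx.
rewrite (_ : mkset _ = E true `|` E false); last first.
  apply/seteqP; split => w.
    move=> [wu Bw]; case wk : (w k); [left|right]; split; rewrite ?addnS//;
      move=> i; rewrite ltnS leq_eqVlt => /predU1P[->|ik]; rewrite ?u'k ?u'E//;
      exact: wu.
  move=> [] [wu Bw]; split; rewrite ?addSnnS// => i ik;
    by rewrite wu ?u'E// ltnW.
have [mt Pt] := IH k.+1 (u' true); have [mf Pf] := IH k.+1 (u' false).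
(* Measurability is carried through the induction because additivity over the two disjoint halves
   requires it. *)
split; first exact: measurableU.
rewrite measureU//; last first.
  by apply/seteqP; split => // w [[/(_ k (ltnSn k)) + _] [/(_ k (ltnSn k)) + _]];
     rewrite !u'k => ->.
rewrite [X in (X + _)%E]Pt [X in (_ + X)%E]Pf -EFinD; congr EFin.
rewrite !big_ord_recr/= !u'k.
have prodE c : \prod_(i < k) (if u' c i then p else 1 - p) =
    \prod_(i < k) (if u i then p else 1 - p).
  by apply: eq_bigr => i _; rewrite u'E.
have trajE c : pair_traj (u' c) k = pair_traj u k.
  by rewrite /pair_traj !(trajectory_eq_prefix f g (u' c) u _ k (u'E c)).
have -> : pair_traj (u' true) k.+1 = (f (pair_traj u k).1, f (pair_traj u k).2).
  by rewrite -(trajE true) /pair_traj /= u'k.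
have -> : pair_traj (u' false) k.+1 = (g (pair_traj u k).1, g (pair_traj u k).2).
  by rewrite -(trajE false) /pair_traj /= u'k.
rewrite !prodE /avg /=; ring.
Qed.

(** The empty prefix [k = 0] of the conditional formula; it turns the probabilities in [Fn] into
    values of [coin_avg]. *)
Lemma coin_prob_trajectory n :
  coin_prob p [set w | B (trajectory f g w x n, trajectory f g w y n)] =
    (avg n (x, y))%:E.
Proof.
have [_] := coin_prob_prefix n 0 (fun=> true).
rewrite big_ord0 mul1r => <-; congr (coin_prob p _).
by apply/seteqP; split => w; rewrite /= addn0; [move=> ?; split|case].
Qed.

End pair_process.

(** * Criteria for vanishing chaos *)

Lemma chaos_measure_eq0 (a b p : R) (f g : R -> R) : a < b -> 0 <= p <= 1 ->
  (forall x y t : R, a <= x <= b -> a <= y <= b ->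
    osc_le (cesaro (fun n => coin_avg p (fun z : R * R => (f z.1, f z.2))
      (fun z : R * R => (g z.1, g z.2)) (fun z => (`|z.1 - z.2| < t)%R%:R) n (x, y))) 0) ->
  chaos_measure a b f g p = 0%E.
Proof.
move=> ab p01 osc0.
have FE x y t : a <= x <= b -> a <= y <= b ->
    (Fup f g p x y t - Flow f g p x y t = 0)%E.
  move=> xab yab; rewrite /Fup /Flow.
  set avg := fun n => coin_avg p (fun z : R * R => (f z.1, f z.2))
    (fun z : R * R => (g z.1, g z.2)) (fun z => (`|z.1 - z.2| < t)%R%:R) n (x, y).
  have -> : Fn f g p x y ^~ t = EFin \o cesaro avg.
    apply/funext => n; rewrite /Fn /= /cesaro EFinM; congr (_ * _)%E.
    rewrite -sumEFin; apply: eq_bigr => i _.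
    exact: (coin_prob_trajectory p f g x y (fun z => `|z.1 - z.2| < t)).
  have cv : cesaro avg @ \oo --> limn (cesaro avg).
    exact: (osc0_cvg _ (osc0 x y t xab yab)).
  have cvE : EFin \o cesaro avg @ \oo --> (limn (cesaro avg))%:E.
    by apply: cvg_EFin cv; exact: nearW.
  have [-> ->] := cvg_limn_einf_sup cvE.
  by rewrite subee.
rewrite /chaos_measure (_ : image2 _ _ _ = [set 0%E]) ?ereal_sup1//.
have int0 x y : a <= x <= b -> a <= y <= b ->
    (((b - a)^-1)%:E * \int[lebesgue_measure]_(t in `[0%R, (b - a)%R])
      (Fup f g p x y t - Flow f g p x y t) = 0)%E.
  by move=> xab yab; rewrite integral0_eq ?mule0// => t _; exact: FE.
(* The pair [(a, a)] shows that the supremum ranges over a nonempty set, hence over exactly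
   [{0}]. *)
have aab : a <= a <= b by rewrite lexx ltW.
apply/seteqP; split => [_ [x + [y + <-]]|_ ->] /=; rewrite ?in_itv /=.
  by move=> xab; rewrite in_itv /= => yab; exact: int0.
by exists a; rewrite /= ?in_itv//; exists a; rewrite /= ?in_itv//; exact: int0.
Qed.

(* Absorption is used twice: from I x I into S x I, then from S x I into S x S,
   where S is the range of s. *)
Lemma chaos_measure_eq0_finite (a b p : R) (f g : R -> R) (m : nat)
    (s : 'I_m -> R) (rf rg : 'I_m -> 'I_m) :
  a < b -> 0 < p < 1 ->
  (forall x, a <= x <= b -> a <= f x <= b) ->
  (forall x, a <= x <= b -> a <= g x <= b) ->
  (forall i, f (s i) = s (rf i)) -> (forall i, g (s i) = s (rg i)) ->
  (forall x, a <= x <= b -> range s (f x) \/ range s (g x)) ->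
  chaos_measure a b f g p = 0%E.
Proof.
move=> ab p01 fI gI fs gs hit; have [p0 p1] := andP p01.
have p01w : 0 <= p <= 1 by rewrite !ltW.
apply: chaos_measure_eq0 => // x y t xab yab.
pose F (z : R * R) := (f z.1, f z.2); pose G (z : R * R) := (g z.1, g z.2).
pose phi (z : R * R) : R := (`|z.1 - z.2| < t)%R%:R.
have phi1 z : `|phi z| <= 1 by rewrite normr_nat /phi lern1; case: (_ < _).
have absorb := @cesaro_absorption _ p 1 F G phi p01 phi1.
have rangef u : range s u -> range s (f u).
  by move=> [i _ <-]; exists (rf i); rewrite ?fs.
have rangeg u : range s u -> range s (g u).
  by move=> [i _ <-]; exists (rg i); rewrite ?gs.
pose SS (z : R * R) := range s z.1 /\ range s z.2.
pose SI (z : R * R) := range s z.1 /\ a <= z.2 <= b.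
pose II (z : R * R) := a <= z.1 <= b /\ a <= z.2 <= b.
apply: (absorb SI II) => //.
- by move=> [u v] [/= ? ?]; split; exact: fI.
- by move=> [u v] [/= ? ?]; split; exact: gI.
- move=> [u v] [/= uI vI]; case: (hit u uI) => hu; [left|right];
    split => //=; [exact: fI|exact: gI].
apply: (absorb SS SI).
- by move=> [u v] [/= ? ?]; split; [exact: rangef|exact: fI].
- by move=> [u v] [/= ? ?]; split; [exact: rangeg|exact: gI].
- move=> [u v] [/= uI vI]; case: (hit v vI) => hv; [left|right];
    split => //=; [exact: rangef|exact: rangeg].
move=> [_ _] [/= [i _ <-] [j _ <-]].
(* On S x S the averages are those of a chain on index pairs, driven by [rf] and [rg], to which the
   result on finite types applies. *)
pose ss (z : 'I_m * 'I_m) := (s z.1, s z.2).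
have avgE n z : coin_avg p F G phi n (ss z) =
    coin_avg p (fun z => (rf z.1, rf z.2)) (fun z => (rg z.1, rg z.2))
      (phi \o ss) n z.
  by elim: n z => [//|n IH] z /=; rewrite -!IH /F /G /ss /= !fs !gs.
rewrite (_ : (fun n => _) = (coin_avg p (fun z => (rf z.1, rf z.2))
    (fun z => (rg z.1, rg z.2)) (phi \o ss))^~ (i, j)).
  exact: cesaro_coin_avg_finite.
by apply/funext => n; rewrite -avgE.
Qed.

(** * Uniform continuity and staircase functions *)

Lemma segment_unif_continuous (a b e : R) (f : R -> R) :
  {within `[a, b], continuous f} -> 0 < e ->
  exists2 d, 0 < d & forall x y, a <= x <= b -> a <= y <= b ->
    `|x - y| < d -> `|f x - f y| < e.
Proof.
move=> fc e0.
pose P d x := a <= x <= b -> forall y, a <= y <= b ->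
  `|x - y| < d -> `|f x - f y| < e.
(* The near-covering form of compactness merges the moduli found locally around each [x] into a
   single one, valid for all small [d > 0]. *)
have nc := (compact_near_coveringP _).1 (@segment_compact _ a b).
have near_P : \forall d \near (0 : R)^'+, `[a, b]%classic `<=` P d.
  apply: nc.
  move=> x; rewrite /= in_itv/= => xab.
  have e2 : 0 < e / 2 by lra.
  have : \forall z \near x, a <= z <= b -> `|f x - f z| < e / 2.
    have /subspace_continuousP /(_ x) := fc; rewrite /= in_itv/= => /(_ xab) /cvgrPdist_lt /(_ _ e2).
    rewrite near_withinE; apply: filterS => z /= h zab; apply: h.
    by rewrite in_itv.
  move=> /nbhs_ballP[r /= r0 rP].
  have rz z : `|x - z| < r -> a <= z <= b -> `|f x - f z| < e / 2 by exact: rP.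
  (* Halving the radius keeps both [z] and any [y] closer than [d] to [z] inside the ball of radius
     [r] around [x]. *)
  exists (ball x (r / 2), [set d | d < r / 2]).
    split; first by apply: nbhsx_ballx; lra.
    by apply: nbhs_right_lt; lra.
  move=> [z d] /= [xz dr] zab y yab zy.
  have hz : `|f x - f z| < e / 2.
    by apply: rz => //; rewrite (lt_le_trans xz)//; lra.
  have hy : `|f x - f y| < e / 2.
    apply: rz => //; rewrite -(subrKA z) (le_lt_trans (ler_normD _ _))//.
    move: xz; rewrite /ball /=; lra.
  move: hz hy; rewrite !ltr_norml; lra.
have [d [dP d0]] : exists d, `[a, b]%classic `<=` P d /\ 0 < d.
  exact: filter_ex (filterI near_P (nbhs_right_gt 0)).
by exists d => // x y xab; apply: dP; rewrite //= in_itv.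
Qed.

(* The ramp from v i to v i.+1 lies over the interval [i + c, i + c + 1/4]. *)
Fixpoint staircase (c : R) (v : nat -> R) n z : R :=
  if n is m.+1 then staircase c v m z +
    (v m.+1 - v m) * Num.max 0 (Num.min 1 (4 * (z - m%:R - c)))
  else v 0%N.

Lemma continuous_staircase c v n : continuous (staircase c v n).
Proof.
elim: n => [|n IH] z /=; first exact: cvg_cst.
apply: cvgD; first exact: IH.
apply: cvgM; first exact: cvg_cst.
apply: (@continuous_max _ _ (cst 0) (cst 1 \min (fun y => 4 * (y - n%:R - c)))).
  exact: cvg_cst.
apply: (@continuous_min _ _ (cst 1)); first exact: cvg_cst.
apply: cvgM; first exact: cvg_cst.
by apply: cvgB; [apply: cvgB; [exact: cvg_id|exact: cvg_cst]|exact: cvg_cst].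
Qed.

(** The last ramp has index [n - 1] and ends at [(n - 1) + c + 1/4], which is the stated
    threshold. *)
Lemma staircase_full c v n z : n%:R + c - 3 / 4 <= z -> staircase c v n z = v n.
Proof.
elim: n => [//|n IH]; rewrite -natr1 => nz /=.
rewrite IH; last lra.
by rewrite min_l ?max_r; lra.
Qed.

(** Ramps of index at least [j] start no earlier than [j + c], so they still contribute 0 at [z]. *)
Lemma staircase_flat c v j n z : (j <= n)%N -> z <= j%:R + c ->
  staircase c v n z = staircase c v j z.
Proof.
move=> + zj; elim: n => [|n IH]; first by rewrite leqn0 => /eqP->.
rewrite leq_eqVlt => /predU1P[->//|]; rewrite ltnS => jn /=.
have : j%:R <= n%:R :> R by rewrite ler_nat.
by move=> jnR; rewrite IH// min_r ?max_l; lra.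
Qed.

(** At most one ramp is in progress at [z], which makes the value a convex combination of at most
    two plateau values, both belonging to cells near [z]. The cases are: before the first ramp, in
    the period of ramp [j], and after the last ramp. *)
Lemma staircase_shape c v n z : 3 / 4 <= c <= 1 -> 0 <= z <= n.+1%:R ->
  exists j k l, [/\ (j <= n)%N /\ (k <= n)%N,
    `|z - (j%:R + 1 / 2)| <= 2 /\ `|z - (k%:R + 1 / 2)| <= 2,
    0 <= l <= 1, staircase c v n z = (1 - l) * v j + l * v k &
    staircase c v n z = v j \/ staircase c v n z = v k \/
      exists i : nat, i%:R + c < z < i%:R + c + 1 / 4].
Proof.
move=> c1 /andP[z0]; rewrite -natr1 => zn.
have [zc|cz] := ltP z c.
  exists 0%N, 0%N, 0; rewrite (staircase_flat _ _ 0 n)/= ?add0r//; last exact: ltW.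
  rewrite lexx ler01 ler_norml; split; [by []|split; lra|by []|lra|by left].
pose j := Num.truncn (z - c).
have zc0 : 0 <= z - c by lra.
have /andP[jz zj] := truncn_itv zc0; rewrite -/j -natr1 in jz zj.
have [jn|nj] := ltnP j n.
  set l := Num.max 0 (Num.min 1 (4 * (z - j%:R - c))).
  have stE : staircase c v n z = v j + (v j.+1 - v j) * l.
    rewrite (staircase_flat _ _ j.+1)//= ?staircase_full//; last by rewrite -natr1; lra.
    lra.
  exists j, j.+1, l; split.
  - by rewrite ltnW.
  - by rewrite -[j.+1%:R]natr1 !ler_norml; split; lra.
  - by rewrite /l le_max lexx/= ge_max ler01/= ge_min lexx.
  - rewrite stE; ring.
  have [h1|h1] := leP z (j%:R + c).
    by left; rewrite stE /l min_r ?max_l ?mulr0 ?addr0//; lra.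
  have [h2|h2] := leP (j%:R + c + 1 / 4) z.
    right; left; rewrite stE /l min_l ?max_r; lra.
  by right; right; exists j; rewrite h1.
have nR : n%:R <= j%:R :> R by rewrite ler_nat.
exists n, n, 0; rewrite staircase_full; last lra.
rewrite lexx ler01 !ler_norml; split; [by []|split; lra|by []|lra|by left].
Qed.

(** * Staircase perturbations of a continuous self-map of the interval *)

Section perturbation.
Context (a b : R) (ab : a < b).

Definition cell_width n : R := (b - a) / n.+1%:R.
Definition midpoint n i : R := a + (i%:R + 1 / 2) * cell_width n.

Let cell_width_gt0 n : 0 < cell_width n.
Proof. by rewrite divr_gt0 ?ltr0n ?subr_gt0. Qed.

Let cell_coordinate n x : a <= x <= b -> 0 <= (x - a) / cell_width n <= n.+1%:R.
Proof.
move=> /andP[ax xb]; have h0 := cell_width_gt0 n.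
rewrite ler_pdivlMr// ler_pdivrMr// mul0r /cell_width mulrCA mulfV ?mulr1 ?pnatr_eq0//.
lra.
Qed.

Lemma midpoint_itv n i : (i <= n)%N -> a <= midpoint n i <= b.
Proof.
move=> i_n; have h0 := cell_width_gt0 n.
have hn : n.+1%:R * cell_width n = b - a.
  by rewrite /cell_width mulrCA mulfV ?mulr1 ?pnatr_eq0.
have iR : i%:R <= n%:R :> R by rewrite ler_nat.
have i0 : 0 <= i%:R :> R by [].
rewrite /midpoint; move: hn; rewrite -natr1; nra.
Qed.

Lemma nearby_midpoint n y : a <= y <= b ->
  exists2 i, (i <= n)%N & `|midpoint n i - y| <= cell_width n.
Proof.
move=> yab; have h0 := cell_width_gt0 n.
have /andP[z0 zn] := cell_coordinate n y yab.
set z := (y - a) / cell_width n in z0 zn.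
have yE : y = a + z * cell_width n by rewrite /z divfK ?gt_eqF//; ring.
have /andP[jz zj] := truncn_itv z0.
set j := Num.truncn z in jz zj.
suff [i i_n iz] : exists2 i, (i <= n)%N & `|i%:R + 1 / 2 - z| <= 1.
  exists i => //; have -> : midpoint n i - y = (i%:R + 1 / 2 - z) * cell_width n.
    by rewrite /midpoint yE; ring.
  rewrite normrM (gtr0_norm h0).
  by rewrite ler_piMl// ltW.
rewrite -[n.+1%:R]natr1 in zn; rewrite -[j.+1%:R]natr1 in zj.
(* The truncation exceeds [n] only at the right end [y = b], where the last cell is taken. *)
have [jn|nj] := leqP j n; [exists j => //|exists n => //]; rewrite ler_norml; first lra.
have : n.+1%:R <= j%:R :> R by rewrite ler_nat.
rewrite -[n.+1%:R]natr1; lra.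
Qed.

(** The threshold [N] is uniform in the ramp offset [c], so two maps can share one subdivision and
    still have ramps in different places. *)
Lemma staircase_approximation (f : R -> R) (e : R) :
  (forall x, a <= x <= b -> a <= f x <= b) ->
  {within `[a, b], continuous f} -> 0 < e ->
  exists N, forall n c, (N <= n)%N -> 3 / 4 <= c <= 1 ->
  exists (fs : R -> R) (r : 'I_n.+1 -> 'I_n.+1),
    [/\ continuous fs, forall x, a <= x <= b -> a <= fs x <= b,
        forall x, a <= x <= b -> `|f x - fs x| <= e,
        forall i : 'I_n.+1, fs (midpoint n i) = midpoint n (r i) &
        forall x, a <= x <= b -> (exists i : 'I_n.+1, fs x = midpoint n i) \/
          exists i : nat, i%:R + c < (x - a) / cell_width n < i%:R + c + 1 / 4].
Proof.
move=> fI fc e0; have e2 : 0 < e / 2 by lra.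
have [d d0 dP] := segment_unif_continuous a b (e / 2) f fc e2.
(* A cell width of at most [e / 2] pays for rounding values to midpoints. One of at most [d / 3]
   keeps points two cells apart within the modulus [d], which costs the other [e / 2]. *)
have m0 : 0 < Num.min (e / 2) (d / 3) by rewrite lt_min e2 divr_gt0.
have [N HN] := near_invn_le (b - a) _ m0.
exists N => n c Nn c1; have h0 := cell_width_gt0 n.
have [_] := HN n.+1 (leqW Nn); rewrite -/(cell_width n) le_min => /andP[he hd].
have /choice[v0 v0P] : forall i : 'I_n.+1, exists k : 'I_n.+1,
    `|midpoint n k - f (midpoint n i)| <= cell_width n.
  move=> i; have [|k kn kP] := nearby_midpoint n (f (midpoint n i)).
    by apply: fI; apply: midpoint_itv; rewrite -ltnS.
  by exists (Ordinal (kn : (k < n.+1)%N)).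
pose v (j : nat) := midpoint n (v0 (inord j)).
have vI j : a <= v j <= b by apply: midpoint_itv; rewrite -ltnS.
have vf j x : (j <= n)%N -> a <= x <= b ->
    `|(x - a) / cell_width n - (j%:R + 1 / 2)| <= 2 -> `|v j - f x| <= e.
  move=> jn xab xj.
  have := v0P (inord j); rewrite inordK// -/(v j) => vj.
  have : `|f (midpoint n j) - f x| < e / 2.
    apply: dP => //; first exact: midpoint_itv.
    have -> : midpoint n j - x = - ((x - a) / cell_width n - (j%:R + 1 / 2)) * cell_width n.
      rewrite /midpoint mulNr mulrBl divfK ?gt_eqF//; ring.
    rewrite normrM normrN (gtr0_norm h0); nra.
  move: vj; rewrite !ler_norml ltr_norml; lra.
pose fs x := staircase c v n ((x - a) / cell_width n).
exists fs, v0; split.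
- move=> x; apply: (@continuous_comp _ _ _ (fun x => (x - a) / cell_width n) (staircase c v n));
    last exact: continuous_staircase.
  by apply: cvgM; [apply: cvgB; [exact: cvg_id|exact: cvg_cst]|exact: cvg_cst].
- move=> x xab; have := staircase_shape c v n _ c1 (cell_coordinate n x xab).
  move=> [j [k [l [_ _ l01 + _]]]]; rewrite /fs => ->.
  have := vI j; have := vI k; nra.
- move=> x xab; have := staircase_shape c v n _ c1 (cell_coordinate n x xab).
  move=> [j [k [l [[jn kn] [xj xk] l01 + _]]]]; rewrite /fs => ->.
  have := vf j x jn xab xj; have := vf k x kn xab xk; rewrite !ler_norml; nra.
- move=> i; rewrite /fs /midpoint addrAC subrr add0r mulfK ?gt_eqF//.
  have i_n : (i <= n)%N by rewrite -ltnS.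
  (* In cell coordinates the midpoint is [i + 1/2]. It lies on plateau [i], between [i + c - 3/4]
     and [i + c], because [3/4 <= c <= 1]. *)
  rewrite (staircase_flat _ _ i)//; last lra.
  rewrite staircase_full; last lra.
  by rewrite /v inord_val.
- move=> x xab; have := staircase_shape c v n _ c1 (cell_coordinate n x xab).
  move=> [j [k [l [_ _ _ _]]]]; rewrite -/(fs x) => -[->|[->|]]; last by right.
    by left; eexists.
  by left; eexists.
Qed.

End perturbation.

End random_dynamics.

Theorem theorem6p1 (R : realType) (a b : R) (f g : R -> R) (p : R) :
  a < b ->
  set_fun `[a, b] `[a, b] f -> set_fun `[a, b] `[a, b] g ->
  {within `[a, b], continuous f} -> {within `[a, b], continuous g} ->
  0 < p < 1 ->
  forall eps : R, 0 < eps ->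
  exists fs gs : R -> R,
    [/\ set_fun `[a, b] `[a, b] fs /\ {within `[a, b], continuous fs},
        set_fun `[a, b] `[a, b] gs /\ {within `[a, b], continuous gs},
        (sup_dist a b f fs < eps%:E)%E,
        (sup_dist a b g gs < eps%:E)%E
      & chaos_measure a b fs gs p = 0%E].
Proof.
have set_funE u : set_fun `[a, b] `[a, b] u <->
    forall x, a <= x <= b -> a <= u x <= b.
  by split=> uI x; have := uI x; rewrite /= !in_itv.
move=> ab /set_funE fI /set_funE gI fc gc p01 eps eps0.
(* A pointwise bound by [eps / 2] keeps the supremum strictly below [eps]. *)
have e2 : 0 < eps / 2 by lra.
have [Nf Hf] := staircase_approximation a b ab f (eps / 2) fI fc e2.
have [Ng Hg] := staircase_approximation a b ab g (eps / 2) gI gc e2.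
pose n := maxn Nf Ng.
(* With offsets [3/4] and [1], the open ramps of [fs] lie over [(i + 3/4, i + 1)] and those of [gs]
   over [(k + 1, k + 5/4)], which never meet. *)
have [fs [rf [fsc fsI fsd fsm fsh]]] := Hf n (3 / 4) (leq_maxl _ _) ltac:(lra).
have [gs [rg [gsc gsI gsd gsm gsh]]] := Hg n 1 (leq_maxr _ _) ltac:(lra).
have sup_lt u us : (forall x, a <= x <= b -> `|u x - us x| <= eps / 2) ->
    (sup_dist a b u us < eps%:E)%E.
  move=> du; apply: (@le_lt_trans _ _ (eps / 2)%:E); last by rewrite lte_fin; lra.
  apply: ge_ereal_sup => _ [x + <-]; rewrite /= in_itv /= lee_fin.
  exact: du.
exists fs, gs; split; [split| split|exact: sup_lt|exact: sup_lt|].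
- exact/set_funE.
- exact: continuous_subspaceT.
- exact/set_funE.
- exact: continuous_subspaceT.
apply: (chaos_measure_eq0_finite a b p fs gs n.+1 (fun i => midpoint a b n i) rf rg) => //.
move=> x xab; have [[i ->]|[i /andP[iz zi]]] := fsh x xab.
  by left; exists i.
have [[k ->]|[k /andP[kz zk]]] := gsh x xab; first by right; exists k.
(* A common point gives [k + 1 < i + 1], so [k + 1 <= i], while [i + 3/4 < k + 5/4] forces
   [i < k + 1/2]. *)
exfalso; have ki : (k < i)%N by rewrite -(ltr_nat R); lra.
have : k.+1%:R <= i%:R :> R by rewrite ler_nat.
rewrite -natr1; lra.
Qed.
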